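(* Let $q\ge 1$ be an integer, let $G$ be a simple connected graph with $n$ nodes and $m$ edges, and let $S_q(G)$ be the $q$-subdivision graph of $G$. Then $$\tilde{\mathcal{K}}(S_q(G))=8q\,\tilde{\mathcal{K}}(G)+2mq(2mq-2n+1).$$
   Context: The $q$-subdivision graph $S_q(G)$ is obtained from $G$ by replacing each edge $uv$ with $q$ disjoint paths of length $2$: $ux_1v,\ldots,ux_qv$. For a connected graph $G$ with node degrees $d_i$, the resistance distance $r_{ij}$ is the effective resistance between $i$ and $j$ when each edge is replaced by a unit resistor. The multiplicative degree-Kirchhoff index is $\tilde{\mathcal K}(G)=\sum_{\{i,j\}\subseteq V(G)}d_id_jr_{ij}$, the sum over unordered pairs of nodes. *)

(* Defs.v *)
From HB Require Import structures.
From mathcomp Require Import all_boot all_order all_algebra.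
From mathcomp Require Import boolp classical_sets.

Set Implicit Arguments.
Unset Strict Implicit.
Unset Printing Implicit Defensive.

Import Order.TTheory GRing.Theory Num.Theory.
Local Open Scope ring_scope.

Record sgraph := SGraph {
  vertex :> finType;
  adj : rel vertex;
  adj_sym : symmetric adj;
  adj_irrefl : irreflexive adj }.

Definition connected (G : sgraph) : Prop :=
  forall x y : G, connect (@adj G) x y.

Definition edges (G : sgraph) : {set {set G}} :=
  [set A | [exists x : G, exists y : G, adj x y && (A == [set x; y])]].

Definition degree (G : sgraph) (x : G) : nat := #|[set y | adj x y]|.

Section Subdivision.
Variables (q : nat) (G : sgraph).

(* [inr (A, k)] is the middle vertex of the k-th path of length 2 that
   replaces the edge A. *)
Definition subdiv_vertex : finType :=
  (G + {A : {set G} | A \in edges G} * 'I_q)%type.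

Definition subdiv_adj : rel subdiv_vertex := fun a b =>
  match a, b with
  | inl u, inr (A, _) => u \in val A
  | inr (A, _), inl u => u \in val A
  | _, _ => false
  end.

Lemma subdiv_adj_sym : symmetric subdiv_adj.
Proof. by move=> [u|[A k]] [v|[B l]]. Qed.

Lemma subdiv_adj_irrefl : irreflexive subdiv_adj.
Proof. by move=> [u|[A k]]. Qed.

Definition subdivision : sgraph := SGraph subdiv_adj_sym subdiv_adj_irrefl.

End Subdivision.

Section Resistance.
Variables (R : realFieldType) (G : sgraph).

(* Potentials v when a unit current enters the network of unit resistors at i
   and leaves it at j: by Ohm's law the current from x to y is v x - v y, and
   Kirchhoff's current law holds at every vertex. *)
Definition unit_current_potential (i j : G) (v : G -> R) : Prop :=
  forall x : G,
    \sum_(y | adj x y) (v x - v y) = (x == i)%:R - (x == j)%:R.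

(* The value exists and is unique when G is connected, see
   [resistance_exists] and [resistanceE]; xget defaults to 0 otherwise. *)
Definition resistance (i j : G) : R :=
  xget 0 [set r | exists2 v, unit_current_potential i j v & r = v i - v j].

(* Comparing positions in the enumeration of the vertices selects each
   unordered pair {i, j} of distinct vertices once; the pairs with i = j have
   resistance 0. *)
Definition degree_kirchhoff : R :=
  \sum_(i : G) \sum_(j : G | (enum_rank i < enum_rank j)%N)
    (degree i)%:R * (degree j)%:R * resistance i j.

Lemma harmonic_constant (f : G -> R) : connected G ->
  (forall x, \sum_(y | adj x y) (f x - f y) = 0) -> forall x y, f x = f y.
Proof.
move=> cG hf.
have sw : \sum_x \sum_(y | adj x y) f x * (f x - f y) =
          \sum_x \sum_(y | adj x y) f y * (f y - f x).
  rewrite (exchange_big_dep predT) //=; apply: eq_bigr => x _.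
  by apply: eq_bigl => y; rewrite adj_sym.
have z : \sum_x \sum_(y | adj x y) f x * (f x - f y) = 0.
  by apply: big1 => x _; rewrite -mulr_sumr hf mulr0.
have E : \sum_x \sum_(y | adj x y) (f x - f y) ^+ 2 = 0.
  transitivity (\sum_x \sum_(y | adj x y) f x * (f x - f y) +
                \sum_x \sum_(y | adj x y) f y * (f y - f x)).
    rewrite -big_split; apply: eq_bigr => x _.
    rewrite -big_split; apply: eq_bigr => y _ /=.
    by rewrite -(opprB (f x) (f y)) mulrN -mulrBl expr2.
  by rewrite -sw z addr0.
have edge x y : adj x y -> f x = f y.
  move=> xy; apply/eqP; rewrite -subr_eq0 -sqrf_eq0; apply/eqP.
  have sq0 a b : adj a b -> 0 <= (f a - f b) ^+ 2 by rewrite sqr_ge0.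
  have E1 : \sum_(b | adj x b) (f x - f b) ^+ 2 = 0.
    apply: (psumr_eq0P _ E) => // a _; apply: sumr_ge0 => b; exact: sq0.
  by apply: (psumr_eq0P _ E1) => // b; exact: sq0.
move=> x y; have /connectP[p] := cG x y.
by elim: p x => [|a p IH] x /= => [_ -> //|/andP[/edge -> pa] /IH]; exact.
Qed.

Lemma resistance_exists : connected G ->
  forall i j, exists v, unit_current_potential i j v.
Proof.
move=> cG i j.
pose L : 'M[R]_#|G| := \matrix_(a, b)
  (\sum_(y | adj (enum_val b) y) ((b == a)%:R - (y == enum_val a)%:R)).
have LE (f : G -> R) b : \sum_a f (enum_val a) * L a b =
    \sum_(y | adj (enum_val b) y) (f (enum_val b) - f y).
  under eq_bigr do rewrite mxE mulr_sumr.
  rewrite exchange_big; apply: eq_bigr => y _ /=.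
  under eq_bigr do rewrite mulrBr.
  rewrite sumrB; congr (_ - _).
    rewrite (bigD1 b) //= eqxx mulr1 big1 ?addr0 // => a /negPf.
    by rewrite eq_sym => ->; rewrite mulr0.
  rewrite (bigD1 (enum_rank y)) //= enum_rankK eqxx mulr1 big1 ?addr0 //.
  move=> a ne; case: eqP => [Ey|]; last by rewrite mulr0.
  by rewrite Ey enum_valK eqxx in ne.
have Ls a b : L a b = L b a.
  rewrite !mxE !sumrB; have [->//|_] := eqVneq a b.
  rewrite !sumr_const !mul0rn; congr (_ - _).
  have h (c d : 'I_#|G|) : \sum_(y | adj (enum_val c) y)
      (y == enum_val d)%:R = (adj (enum_val c) (enum_val d))%:R :> R.
    rewrite big_mkcond /= (bigD1 (enum_val d)) //= eqxx big1 ?addr0.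
      by case: adj.
    by move=> y /negPf ->; case: ifP.
  by rewrite !h adj_sym.
pose c : 'rV[R]_#|G| :=
  \row_a ((enum_val a == i)%:R - (enum_val a == j)%:R).
have /submxP[D cE] : (c <= L)%MS.
  rewrite submxE; apply/eqP/matrixP => a k; rewrite !mxE.
  pose f x := cokermx L (enum_rank x) k.
  have fc : forall x y, f x = f y.
    apply: harmonic_constant => // x.
    have := LE f (enum_rank x); rewrite enum_rankK => <-.
    have /matrixP/(_ (enum_rank x) k) := mulmx_coker L.
    rewrite !mxE => H; rewrite -[RHS]H; apply: eq_bigr => b _.
    by rewrite /f enum_valK mulrC Ls.
  have fi b : cokermx L b k = f i by rewrite -(fc (enum_val b)) /f enum_valK.
  under eq_bigr do rewrite fi mxE.
  rewrite -mulr_suml (reindex (@enum_rank G)) /=; last first.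
    by apply: onW_bij; exact: enum_rank_bij.
  under eq_bigr do rewrite enum_rankK.
  rewrite sumrB.
  have one (s : G) : \sum_x (x == s)%:R = 1 :> R.
    by rewrite (bigD1 s) //= eqxx big1 ?addr0 // => x /negPf ->.
  by rewrite !one subrr mul0r.
exists (fun x => D 0 (enum_rank x)) => x.
have := LE (fun x => D 0 (enum_rank x)) (enum_rank x).
rewrite enum_rankK => <-.
have /matrixP/(_ 0 (enum_rank x)) := cE; rewrite !mxE enum_rankK => ->.
by apply: eq_bigr => b _; rewrite enum_valK.
Qed.

Lemma resistanceE : connected G -> forall i j v,
  unit_current_potential i j v -> resistance i j = v i - v j.
Proof.
move=> cG i j v hv; apply: xget_unique; first by exists v.
move=> _ [w hw ->].
have := @harmonic_constant (fun x => w x - v x) cG _ i j.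
have H x : \sum_(y | adj x y) (w x - v x - (w y - v y)) = 0.
  under eq_bigr do rewrite opprD addrACA -opprD.
  by rewrite sumrB hw hv subrr.
move=> /(_ H) E; apply: subr0_eq.
by rewrite opprD addrACA -opprD E subrr.
Qed.

End Resistance.

(* Main.v *)
Require Import Defs.
From mathcomp Require Import all_boot all_order all_algebra.
From mathcomp Require Import boolp ring.
Import GRing.Theory Num.Theory.
Local Open Scope ring_scope.

(** Resistances are replaced by a Green kernel.  Fix a vertex o of the connected
graph G and let g(., j) be a potential for a unit current entering at j and
leaving at o.  Superposition gives r_ij = g(i,i) - g(i,j) + g(j,j) - g(j,i)
for every choice of the additive constants in the columns of g, and summing
against d_i d_j over unordered pairs gives
   K(G) = D T - Q,  where D = sum_x d_x,  T = sum_x d_x g(x,x),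
                          Q = sum_{x,y} d_x d_y g(x,y)
([degree_kirchhoff_green]).  So only D, T and Q have to be followed from G to
S_q(G).

A kernel for S_q(G), grounded at the same vertex o, comes from that of G.
Extend a function f on G to the new vertices by giving the middle of uv the
value (f(u) + f(v)) / 2.  No current is then lost at the middle vertices, and
each edge of G has become q parallel paths of resistance 2, so the Laplacian at
an old vertex is multiplied by q/2.  Hence 2/q times g, extended in both
variables, is a kernel for the sources placed at old vertices.  A unit source
at the middle of uv acts as two sources 1/2 at u and v, together with the
voltage 1/2 needed to push the current out through two parallel unit
resistors; this adds 1/2 on the diagonal at the middle vertices
([subdivision_greenP]).

Write m for the number of edges and n for the number of vertices of G.  The
degrees of S_q(G) are q d_x at old vertices and 2 at new ones, and they are
compatible with the extension: the degree-weighted sum of an extended function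
is 2q times that of the function ([sum_degree_extension]).  Therefore
   D' = 4mq   and   Q' = (2/q) (2q)^2 Q + (1/2) 4 mq = 8q Q + 2mq.
In T' the middle vertices contribute the sums of g over pairs of endpoints of
an edge; their off-diagonal part is the sum of g(y,x) over adjacent (x,y),
which by the current law at the sources equals T - (n - 1)
([sum_adj_green], a form of Foster's theorem).  This gives
   T' = 4T - (n - 1) + mq,
and D' T' - Q' = 8q (2m T - Q) + 2mq (2mq - 2n + 1). *)

(** * Green kernels and the degree-Kirchhoff index *)

Section GreenKernel.
Set Implicit Arguments.
Unset Strict Implicit.
Variables (R : realFieldType) (G : sgraph).
Implicit Types (i j o x y : G) (f : G -> R) (g : G -> G -> R).

Definition laplacian f x : R := \sum_(y | adj x y) (f x - f y).

Lemma laplacianD f h x :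
  laplacian (fun z => f z + h z) x = laplacian f x + laplacian h x.
Proof.
by rewrite -big_split /=; apply: eq_bigr => y _; rewrite opprD addrACA.
Qed.

Lemma laplacianZ (c : R) f x :
  laplacian (fun z => c * f z) x = c * laplacian f x.
Proof. by rewrite mulr_sumr; apply: eq_bigr => y _; rewrite mulrBr. Qed.

Lemma laplacian_sum (I : finType) (P : pred I) (F : I -> G -> R) x :
  laplacian (fun z => \sum_(k | P k) F k z) x =
  \sum_(k | P k) laplacian (F k) x.
Proof.
by rewrite exchange_big /=; apply: eq_bigr => y _; rewrite sumrB.
Qed.

(** The column of index [j] is a potential for the unit current from [j] to the
ground [o]; on a connected graph this determines each column up to an additive
constant of its own. *)
Definition grounded_green o g : Prop :=
  forall j x, laplacian (g^~ j) x = (x == j)%:R - (x == o)%:R.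

Lemma grounded_green_exists o :
  connected G -> exists g, grounded_green o g.
Proof.
move=> cG.
have [v vP] := choice (fun j => resistance_exists R cG j o).
by exists (fun x j => v j x) => j x; exact: vP.
Qed.

(** By superposition the difference of the columns [i] and [j] is a potential
for the unit current from [i] to [j]: the currents into the ground cancel. *)
Lemma resistance_green o g i j : connected G -> grounded_green o g ->
  resistance R i j = (g i i - g i j) + (g j j - g j i).
Proof.
move=> cG gP; rewrite (@resistanceE R G cG i j (fun x => g x i - g x j)).
  ring.
move=> x; rewrite -/(laplacian _ x).
have -> : laplacian (fun z => g z i - g z j) x =
    laplacian (g^~ i) x - laplacian (g^~ j) x.
  by rewrite /laplacian -sumrB; apply: eq_bigr => y _; ring.
by rewrite !gP; ring.
Qed.

(** Each ordered pair of distinct vertices occurs once, either as the selected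
representative of an unordered pair or as its reversal. *)
Lemma sum_unordered_pairs (h : G -> G -> R) : (forall i, h i i = 0) ->
  \sum_i \sum_(j | (enum_rank i < enum_rank j)%N) (h i j + h j i) =
  \sum_i \sum_j h i j.
Proof.
move=> h0.
under eq_bigr do rewrite big_split /=.
rewrite big_split /=.
rewrite [X in _ + X](exchange_big_dep predT) //= -big_split /=.
apply: eq_bigr => i _.
rewrite [RHS](bigID (fun j => enum_rank i < enum_rank j)%N) /=.
congr (_ + _).
rewrite [RHS](bigD1 i) /= ?ltnn // h0 add0r; apply: eq_bigl => j.
rewrite -leqNgt ltn_neqAle (inj_eq (@ord_inj _)) (inj_eq enum_rank_inj).
by rewrite andbC.
Qed.

(** The resistance splits as the sum of [g i i - g i j] and its transpose, so
the sum over unordered pairs becomes a sum of the first part over all ordered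
pairs, which separates into a product and a bilinear form. *)
Lemma degree_kirchhoff_green o g : connected G -> grounded_green o g ->
  degree_kirchhoff R G =
  (\sum_(x : G) (degree x)%:R) * (\sum_x (degree x)%:R * g x x)
  - \sum_x \sum_y (degree x)%:R * (degree y)%:R * g x y.
Proof.
move=> cG gP.
(* the part of the (i, j) term whose sum with its transpose is the term *)
pose h i j := (degree i)%:R * (degree j)%:R * (g i i - g i j).
transitivity (\sum_i \sum_j h i j).
  rewrite -sum_unordered_pairs => [|i]; last by rewrite /h subrr mulr0.
  apply: eq_bigr => i _; apply: eq_bigr => j _.
  by rewrite (resistance_green _ _ cG gP) /h; ring.
rewrite mulr_sumr -sumrB; apply: eq_bigr => i _.
rewrite mulr_suml -sumrB; apply: eq_bigr => j _.
by rewrite /h; ring.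
Qed.

Lemma natr_degree x : (degree x)%:R = \sum_(y | adj x y) 1 :> R.
Proof.
rewrite sumr_const /degree; congr (_ *+ _).
by apply: eq_card => y; rewrite inE.
Qed.

(** Foster's theorem in terms of the kernel: the drop of potential from [x] to
its neighbours under the source at [x] is 1, except at the ground, where source
and sink cancel; so the total drop is [#|G| - 1]. *)
Lemma sum_adj_green o g : grounded_green o g ->
  \sum_x \sum_(y | adj x y) g y x =
  \sum_x (degree x)%:R * g x x - (#|G|%:R - 1).
Proof.
move=> gP.
have -> : #|G|%:R - 1 = \sum_x laplacian (g^~ x) x.
  under eq_bigr do rewrite gP eqxx.
  rewrite sumrB sumr_const; congr (_ - _).
  by rewrite (bigD1 o) //= eqxx big1 ?addr0 // => x /negPf ->.
rewrite -sumrB; apply: eq_bigr => x _.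
by rewrite natr_degree mulr_suml -sumrB; apply: eq_bigr => y _; ring.
Qed.

End GreenKernel.

(** * Sums over edges and incidences *)

Section Edges.
Set Implicit Arguments.
Unset Strict Implicit.
Variables (R : realFieldType) (G : sgraph).
Implicit Types (x y : G).

Lemma edge_at x (A : {set G}) :
  (A \in edges G) && (x \in A) = (A \in [set [set x; y] | y in adj x]).
Proof.
apply/andP/imsetP => [[]|[y xy ->]].
  rewrite inE => /existsP[a /existsP[b /andP[ab /eqP->]]].
  rewrite !inE => /orP[] /eqP->; first by exists b.
  by exists a; [rewrite -topredE /= adj_sym | rewrite setUC].
rewrite !inE eqxx; split=> //.
by apply/existsP; exists x; apply/existsP; exists y; rewrite [adj x y]xy /=.
Qed.

(** The edges at [x] correspond to the neighbours of [x] by [y |-> [set x; y]],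
which is injective on neighbours since there are no loops. *)
Lemma sum_edges_at x (F : {set G} -> R) :
  \sum_(A : {A : {set G} | A \in edges G} | x \in val A) F (val A) =
  \sum_(y | adj x y) F [set x; y].
Proof.
rewrite -(big_sub_cond (mem (edges G)) (fun A : {set G} => x \in A)).
rewrite -(big_imset (h := fun y => [set x; y]) F); last first.
  move=> y z xy xz /setP/(_ y); rewrite !inE eqxx orbT.
  case: eqP => [yx|_ /esym/eqP //].
  by move: xy; rewrite yx -topredE /= adj_irrefl.
by apply: eq_bigl => A; rewrite -edge_at.
Qed.

(** Double counting of the pairs (endpoint, edge), that is of the ordered pairs
of adjacent vertices.  It turns every sum over the new vertices of a
subdivision into a sum over the adjacency relation of [G]. *)
Lemma sum_incidences (F : G -> {set G} -> R) :
  \sum_(A : {A : {set G} | A \in edges G}) \sum_(x in val A) F x (val A) =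
  \sum_x \sum_(y | adj x y) F x [set x; y].
Proof.
rewrite (exchange_big_dep predT) //=.
by apply: eq_bigr => x _; rewrite sum_edges_at.
Qed.

Lemma card_edge (A : {A : {set G} | A \in edges G}) : #|val A| = 2%N.
Proof.
have := valP A; rewrite inE => /existsP[a /existsP[b /andP[ab /eqP->]]].
by rewrite cards2; case: eqP ab => // ->; rewrite adj_irrefl.
Qed.

Lemma sum_edge_cst (A : {A : {set G} | A \in edges G}) (c : R) :
  \sum_(x in val A) c = 2%:R * c.
Proof. by rewrite sumr_const card_edge mulr_natl. Qed.

Lemma sum_adjacent x y (f : G -> R) :
  adj x y -> \sum_(z in [set x; y]) f z = f x + f y.
Proof.
move=> xy; rewrite big_setU1 ?big_set1 // inE.
by case: eqP xy => // ->; rewrite adj_irrefl.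
Qed.

Lemma sum_vertex_indicator o (A : {set G}) :
  \sum_(y in A) (o == y)%:R = (o \in A)%:R :> R.
Proof.
rewrite big_mkcond (bigD1 o) //= eqxx big1 ?addr0; first by case: (o \in A).
by move=> y /negPf; rewrite eq_sym => ->; case: ifP.
Qed.

Lemma sum_edges_cst (c : R) :
  \sum_(A : {A : {set G} | A \in edges G}) c = #|edges G|%:R * c.
Proof.
by rewrite sumr_const mulr_natl card_sig.
Qed.

Lemma sum_degree : \sum_(x : G) (degree x)%:R = 2%:R * #|edges G|%:R :> R.
Proof.
under eq_bigr do rewrite natr_degree.
rewrite -(sum_incidences (fun _ _ => 1)).
under eq_bigr do rewrite sum_edge_cst mulr1.
by rewrite sum_edges_cst mulrC.
Qed.

End Edges.

(** * The Green kernel of the subdivision *)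

Section Subdivision.
Set Implicit Arguments.
Unset Strict Implicit.
Variables (R : realFieldType) (q : nat) (G : sgraph).
Hypothesis q_gt0 : (0 < q)%N.
Notation S := (subdivision q G).
Notation edge := {A : {set G} | A \in edges G}.
Implicit Types (x y : G) (f : G -> R) (g : G -> G -> R).

Let vtx (x : G) : S := inl x.
Let mid (A : edge) (k : 'I_q) : S := inr (A, k).

(** An edge of [G] is a path through its first middle vertex, which exists since
[q] is positive, and each middle vertex is adjacent to an old one. *)
Lemma subdivision_connected : connected G -> connected S.
Proof.
move=> cG; have symS := sym_connect_sym (@adj_sym S).
have vv x y : connect (@adj S) (vtx x) (vtx y).
  have /connectP[p] := cG x y.
  elim: p x => [|z p IH] x /= => [_ ->|/andP[xz /IH{}IH] /IH].
    exact: connect0.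
  apply: connect_trans.
  have eA : [set x; z] \in edges G.
    rewrite inE; apply/existsP; exists x; apply/existsP; exists z.
    by rewrite xz eqxx.
  pose c := mid (Sub [set x; z] eA) (Ordinal q_gt0).
  apply: (connect_trans (y := c)); apply: connect1;
    by rewrite /= !inE eqxx ?orbT.
have av (a : S) : exists x, connect (@adj S) a (vtx x).
  case: a => [x|[A k]]; first by exists x; exact: connect0.
  have /card_gt0P[x xA] : (0 < #|val A|)%N by rewrite card_edge.
  by exists x; apply: connect1.
move=> a b; have [[x ax] [y yb]] := (av a, av b).
apply: connect_trans ax (connect_trans (vv x y) _).
by rewrite symS.
Qed.

Lemma sum_subdivision (F : S -> R) :
  \sum_a F a = \sum_x F (vtx x) + \sum_A \sum_k F (mid A k).
Proof.
rewrite big_sumType /= pair_bigA /=; congr (_ + _).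
by apply: eq_bigr => -[A k].
Qed.

Lemma sum_adj_vtx x (F : S -> R) :
  \sum_(b | adj (vtx x) b) F b =
  \sum_(A : edge | x \in val A) \sum_k F (mid A k).
Proof.
rewrite big_sumType /= big_pred0_eq add0r pair_big_dep /=.
by apply: eq_big => -[A k] //=; rewrite andbT.
Qed.

Lemma sum_adj_mid A k (F : S -> R) :
  \sum_(b | adj (mid A k) b) F b = \sum_(x in val A) F (vtx x).
Proof. by rewrite big_sumType /= [X in _ + X]big_pred0 ?addr0 // => -[]. Qed.

Lemma sum_copies (c : R) : \sum_(k < q) c = q%:R * c.
Proof. by rewrite sumr_const card_ord mulr_natl. Qed.

Lemma degree_vtx x : (degree (vtx x))%:R = q%:R * (degree x)%:R :> R.
Proof.
rewrite !natr_degree sum_adj_vtx.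
by rewrite (sum_edges_at x (fun=> \sum_(k < q) 1)) sum_copies mulr_sumr.
Qed.

Lemma degree_mid A k : (degree (mid A k))%:R = 2%:R :> R.
Proof. by rewrite natr_degree sum_adj_mid sum_edge_cst mulr1. Qed.

Definition midpoint_extension f (a : S) : R :=
  match a with
  | inl x => f x
  | inr (A, _) => 2%:R^-1 * \sum_(x in val A) f x
  end.

(** Each edge of [G] has become [q] parallel paths, and half of the voltage
across it lies between an old vertex and the middle of the path. *)
Lemma laplacian_extension_vtx f x :
  laplacian (midpoint_extension f) (vtx x) = q%:R / 2%:R * laplacian f x.
Proof.
rewrite /laplacian sum_adj_vtx /=.
rewrite (sum_edges_at x
  (fun A => \sum_(k < q) (f x - 2%:R^-1 * \sum_(y in A) f y))).
rewrite mulr_sumr; apply: eq_bigr => y xy.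
by rewrite sum_copies sum_adjacent //; field.
Qed.

Lemma laplacian_extension_mid f A k :
  laplacian (midpoint_extension f) (mid A k) = 0.
Proof.
rewrite /laplacian sum_adj_mid /= sumrB sum_edge_cst mulrA divff ?mul1r ?subrr //.
by rewrite pnatr_eq0.
Qed.

(** A middle vertex has degree 2 and takes the average of its two endpoints, so
it hands the weight 1 to each; an old vertex [x] receives [q * degree x] in
this way, besides its own degree [q * degree x]. *)
Lemma sum_degree_extension f :
  \sum_(a : S) (degree a)%:R * midpoint_extension f a =
  2%:R * q%:R * \sum_x (degree x)%:R * f x.
Proof.
rewrite sum_subdivision.
under eq_bigr do rewrite degree_vtx /=.
under [X in _ + X]eq_bigr do under eq_bigr do rewrite degree_mid /=.
under [X in _ + X]eq_bigr do
  rewrite sum_copies mulVKf ?pnatr_eq0 // mulr_sumr.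
rewrite (sum_incidences (fun x _ => q%:R * f x)) -big_split mulr_sumr /=.
apply: eq_bigr => x _.
rewrite natr_degree mulr_sumr !mulr_suml mulr_sumr -big_split /=.
by apply: eq_bigr => y _; ring.
Qed.

(** This is [sum_degree_extension] at the constant function 1, which is its own
extension. *)
Lemma sum_degree_subdivision :
  \sum_(a : S) (degree a)%:R = 4%:R * #|edges G|%:R * q%:R :> R.
Proof.
have := sum_degree_extension (fun=> 1).
under [X in _ = _ * X]eq_bigr do rewrite mulr1.
rewrite (sum_degree R G) => H.
transitivity (2%:R * q%:R * (2%:R * #|edges G|%:R) : R); last by ring.
rewrite -H; apply: eq_bigr => -[x|[A k]] _ /=; first by rewrite mulr1.
by rewrite sum_edge_cst mulr1 mulVf ?pnatr_eq0 // mulr1.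
Qed.

Definition is_mid (a : S) : bool := if a is inr _ then true else false.

(** The first term answers to the effective conductance [q / 2] of an edge of
[G].  In the second, 1/2 is the resistance from a middle vertex to its two
endpoints short-circuited together. *)
Definition subdivision_green g (a b : S) : R :=
  2%:R / q%:R *
    midpoint_extension (fun y => midpoint_extension (g^~ y) a) b
  + 2%:R^-1 * (is_mid b && (a == b))%:R.

Let q_neq0 : q%:R != 0 :> R.
Proof. by rewrite pnatr_eq0 -lt0n. Qed.

(** The next two lemmas compute the currents of the local term of
[subdivision_green]: a unit potential at one middle vertex sends a unit current
to each of its two endpoints. *)
Lemma laplacian_mid_vtx B l x :
  laplacian (fun a => (a == mid B l)%:R) (vtx x) = - (x \in val B)%:R :> R.
Proof.
rewrite /laplacian sum_adj_vtx /=.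
under eq_bigr do under eq_bigr do rewrite sub0r.
under eq_bigr do rewrite sumrN.
rewrite sumrN; congr (- _).
rewrite pair_big_dep /= big_mkcond (bigD1 (B, l)) //= eqxx big1 ?addr0.
  by rewrite andbT; case: ifP.
move=> [A k] /= ne; case: ifP => // _; case: eqP => // -[E1 E2].
by rewrite E1 E2 eqxx in ne.
Qed.

Lemma laplacian_mid_mid B l A k :
  laplacian (fun a => (a == mid B l)%:R) (mid A k) =
  2%:R * (mid A k == mid B l)%:R :> R.
Proof.
rewrite /laplacian sum_adj_mid /=.
by under eq_bigr do rewrite subr0; rewrite sum_edge_cst.
Qed.

(** For a source at a middle vertex, the extended potentials with sources 1/2 at
its endpoints and the local term cancel at these endpoints, and leave the unit
source at the middle vertex and the unit sink at the ground. *)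
Lemma subdivision_greenP o g :
  grounded_green o g -> grounded_green (vtx o) (subdivision_green g).
Proof.
move=> gP b a; rewrite /subdivision_green laplacianD !laplacianZ.
case: b => [j|[B l]] /=.
  rewrite [X in _ + _ * X]big1 => [|c _]; last by rewrite subrr.
  rewrite mulr0 addr0; case: a => [x|[A k]].
    by rewrite laplacian_extension_vtx gP !eqE /=; field; rewrite q_neq0.
  by rewrite laplacian_extension_mid mulr0 subrr.
rewrite laplacianZ laplacian_sum; case: a => [x|[A k]].
  under eq_bigr do rewrite laplacian_extension_vtx gP.
  rewrite -mulr_sumr sumrB sum_vertex_indicator sum_edge_cst.
  rewrite (laplacian_mid_vtx B l x) !eqE /=.
  by field; rewrite q_neq0.
under eq_bigr do rewrite laplacian_extension_mid.
rewrite (laplacian_mid_mid B l A k) big1 // !mulr0 add0r subr0.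
by rewrite mulrA mulVf ?mul1r ?pnatr_eq0.
Qed.

(** The middle vertices contribute, for each edge, the sum of [g] over all
ordered pairs of its endpoints.  Over all edges the diagonal parts add up to
the degree-weighted trace of [g], and the off-diagonal parts are given by
[sum_adj_green]. *)
Lemma trace_green_subdivision o g : grounded_green o g ->
  \sum_(a : S) (degree a)%:R * subdivision_green g a a =
  4%:R * (\sum_x (degree x)%:R * g x x) - (#|G|%:R - 1)
  + #|edges G|%:R * q%:R.
Proof.
move=> gP; rewrite sum_subdivision /subdivision_green /=.
under eq_bigr do rewrite degree_vtx mulr0 addr0.
under [X in _ + X]eq_bigr do under eq_bigr do rewrite degree_mid eqxx.
under [X in _ + X]eq_bigr do rewrite sum_copies.
have -> : \sum_x q%:R * (degree x)%:R * (2%:R / q%:R * g x x) =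
    2%:R * \sum_x (degree x)%:R * g x x.
  by rewrite mulr_sumr; apply: eq_bigr => x _; field.
have -> : \sum_(A : edge) q%:R * (2%:R * (2%:R / q%:R *
    (2%:R^-1 * \sum_(y in val A) 2%:R^-1 * \sum_(x in val A) g x y)
    + 2%:R^-1 * 1)) =
    \sum_(A : edge) \sum_(y in val A) \sum_(x in val A) g x y
    + #|edges G|%:R * q%:R.
  rewrite -sum_edges_cst -big_split /=.
  by apply: eq_bigr => A _; rewrite -mulr_sumr; field.
rewrite (sum_incidences (fun y A => \sum_(x in A) g x y)).
have -> : \sum_y \sum_(z | adj y z) \sum_(x in [set y; z]) g x y =
    \sum_x (degree x)%:R * g x x + \sum_x \sum_(y | adj x y) g y x.
  rewrite -big_split; apply: eq_bigr => x _ /=.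
  rewrite natr_degree mulr_suml -big_split; apply: eq_bigr => y xy /=.
  by rewrite sum_adjacent // mul1r.
by rewrite (sum_adj_green gP); ring.
Qed.

(** The weights pass through both extensions by [sum_degree_extension], with the
factor [(2 * q) ^ 2] in all; the local term only sees the [q] times [#|edges G|]
middle vertices. *)
Lemma total_green_subdivision g :
  \sum_(a : S) \sum_b (degree a)%:R * (degree b)%:R * subdivision_green g a b =
  8%:R * q%:R * (\sum_x \sum_y (degree x)%:R * (degree y)%:R * g x y)
  + 2%:R * #|edges G|%:R * q%:R.
Proof.
have row (a : S) :
    \sum_b (degree a)%:R * (degree b)%:R * subdivision_green g a b =
    4%:R * (\sum_y (degree y)%:R *
             ((degree a)%:R * midpoint_extension (g^~ y) a))
    + 2%:R^-1 * (is_mid a)%:R * (degree a)%:R ^+ 2.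
  have -> : 2%:R^-1 * (is_mid a)%:R * (degree a)%:R ^+ 2 =
      \sum_b (degree a)%:R * (degree b)%:R *
        (2%:R^-1 * (is_mid b && (a == b))%:R) :> R.
    rewrite (bigD1 a) //= eqxx andbT big1 ?addr0; first by ring.
    by move=> b /negPf; rewrite eq_sym => ->; rewrite andbF !mulr0.
  transitivity ((degree a)%:R * (2%:R / q%:R) * (\sum_b (degree b)%:R *
      midpoint_extension (fun y => midpoint_extension (g^~ y) a) b)
    + \sum_b (degree a)%:R * (degree b)%:R *
        (2%:R^-1 * (is_mid b && (a == b))%:R)).
    rewrite mulr_sumr -big_split /=; apply: eq_bigr => b _.
    by rewrite /subdivision_green; ring.
  congr (_ + _); rewrite sum_degree_extension.
  rewrite !mulr_sumr; apply: eq_bigr => y _; by field.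
under eq_bigr do rewrite row.
rewrite big_split /= -mulr_sumr exchange_big /=; congr (_ + _).
  under eq_bigr do rewrite -mulr_sumr sum_degree_extension.
  rewrite [in RHS]exchange_big !mulr_sumr; apply: eq_bigr => y _ /=.
  by rewrite !mulr_sumr; apply: eq_bigr => x _; ring.
rewrite sum_subdivision /=.
rewrite big1 => [|x _]; last by rewrite mulr0 mul0r.
under [X in _ + X]eq_bigr do under eq_bigr do rewrite degree_mid.
under [X in _ + X]eq_bigr do rewrite sum_copies.
by rewrite sum_edges_cst; field.
Qed.

End Subdivision.

(** * The degree-Kirchhoff index of the subdivision *)

Theorem theorem6p4 (R : realFieldType) (q : nat) (G : sgraph) (n m : nat)
    (q_ge1 : (1 <= q)%N) (G_connected : connected G)
    (G_n : #|G| = n) (G_m : #|edges G| = m) :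
  degree_kirchhoff R (subdivision q G) =
    8%:R * q%:R * degree_kirchhoff R G
    + 2%:R * m%:R * q%:R * (2%:R * m%:R * q%:R - 2%:R * n%:R + 1).
Proof.
(* the empty graph has no vertex to serve as the ground *)
case: (pickP G) => [o _|G0]; last first.
  have e0 (A : {set G}) : A \in edges G = false.
    by rewrite inE; apply/existsP => -[x]; have := G0 x.
  rewrite -G_m (eq_card0 e0) mulr0 !mul0r addr0 /degree_kirchhoff !big1 ?mulr0 //.
    by move=> x; have := G0 x.
  by move=> [x|[[A eA] k]]; [have := G0 x|have := e0 A; rewrite eA].
have [g gP] := grounded_green_exists R o G_connected.
have S_connected := subdivision_connected q_ge1 G_connected.
rewrite (degree_kirchhoff_green S_connected (subdivision_greenP q_ge1 gP)).
rewrite (degree_kirchhoff_green G_connected gP).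
rewrite sum_degree_subdivision sum_degree (trace_green_subdivision q_ge1 gP).
by rewrite (total_green_subdivision q_ge1) G_n G_m; ring.
Qed.
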